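(* Let $(I(t))_{t\ge 0}$ be an admissible family on $C_\kappa$ (see context) with constants $\omega\ge 0$, $t_0>0$, $\epsilon_0\in(0,1]$, $L\ge 0$ and step sizes $(h_n)_{n\in\mathbb N}$, and let $(S(t))_{t\ge 0}$ be the associated semigroup. Suppose there is a function $\rho_1\colon\mathbb R_+^2\to\mathbb R_+$, non-decreasing in both arguments, with $$\|I(h_n)f-f\|_\kappa\le\rho_1\big(d^{-1/2}\|Df\|_\infty,\,d^{-1}\|D^2f\|_\infty\big)h_n\quad\text{for all } n\in\mathbb N,\ f\in C_b^\infty .$$ Then $$\|I(h_n)^kf-I(h_n)^lf\|_\kappa\le e^{\omega T}\big(2r\delta+\rho_1(r,b_{0,1}r\delta^{-1})|k-l|h_n\big),$$ $$\|S(s)f-S(t)f\|_\kappa\le e^{\omega T}\big(2r\delta+\rho_1(r,b_{0,1}r\delta^{-1})|s-t|\big)$$ for all $r,T\ge 0$, $\delta>0$, $f\in\mathrm{Lip}_b(r)$, $k,l,n\in\mathbb N$ with $kh_n,lh_n\in[0,T]$, and $s,t\in[0,T]$.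
   Context: Spaces. $\kappa\colon\mathbb R^d\to(0,1]$ is continuous with $c_\kappa:=\sup_{x\in\mathbb R^d}\sup_{|y|\le 1}\kappa(x)/\kappa(x-y)<\infty$. $C_\kappa$ is the space of continuous $f\colon\mathbb R^d\to\mathbb R$ with $\|f\|_\kappa:=\sup_x|f(x)|\kappa(x)<\infty$, endowed with the mixed topology: a sequence $f_n\to f$ in $C_\kappa$ iff $\sup_n\|f_n\|_\kappa<\infty$ and $f_n\to f$ uniformly on compact sets. All limits in $C_\kappa$ are in this sense; inequalities between functions are pointwise; $\|f\|_\infty=\sup|f|$; $|\cdot|$ is the Euclidean norm; $\mathbb R_+=[0,\infty)$; $B_{\mathbb R^d}(r)$ is the closed ball of radius $r$. $\mathrm{Lip}_b(r)$ is the set of $r$-Lipschitz $f\colon\mathbb R^d\to\mathbb R$ with $\|f\|_\infty\le r$. $C_b^\infty$ is the set of bounded smooth functions on $\mathbb R^d$ with all partial derivatives bounded; $\|D^lf\|_\infty:=\big\|\big(\sum_{|\gamma|=l}|D^\gamma f|^2\big)^{1/2}\big\|_\infty$ (sum over multi-indices), $D=D^1$. $(\tau_xf)(y):=f(x+y)$. Admissible family. $(h_n)_{n\in\mathbb N}\subset(0,1]$ with $h_n\to 0$. For operators $I(t)\colon C_\kappa\to C_\kappa$, $t\ge 0$, put $I(\pi_n^t):=I(h_n)^{k_n^t}$ with $k_n^t:=\max\{k\in\mathbb N_0: kh_n\le t\}$, and $I'(0)f:=\lim_{h\downarrow 0}(I(h)f-f)/h\in C_\kappa$ whenever this limit exists.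 The family is called admissible with constants $\omega,t_0,\epsilon_0,L$ if: (1) $I(0)=\mathrm{id}$; (2) each $I(t)$ is convex and monotone with $I(t)0=0$; (3) $\|I(t)f-I(t)g\|_\kappa\le e^{\omega t}\|f-g\|_\kappa$ for all $t\in[0,1]$, $f,g\in C_\kappa$; (4) $\|I(t)(\tau_xf)-\tau_xI(t)f\|_\kappa\le Lrt|x|$ for all $t\in[0,t_0]$, $x\in B_{\mathbb R^d}(\epsilon_0)$, $r\ge 0$, $f\in\mathrm{Lip}_b(r)$; (5) for every $f\in C_b^\infty$, $I'(0)f\in C_\kappa$ exists and there are $c\ge 0$, $s_0>0$ with $\|I(t)f-f\|_\kappa\le ct$ for $t\in[0,s_0]$; (6) for every $t\ge 0$, compact $K\subset\mathbb R^d$ and $(f_k)\subset C_\kappa$ with $f_k\downarrow 0$, $\sup_{(s,x)\in[0,t]\times K}\sup_n(I(\pi_n^s)f_k)(x)\downarrow 0$ as $k\to\infty$; (7) $I(t)\colon\mathrm{Lip}_b(r)\to\mathrm{Lip}_b(e^{\omega t}r)$ for all $r,t\ge 0$. Associated semigroup. For an admissible family it is known that $S(t)f:=\lim_{n\to\infty}I(\pi_n^t)f$ exists for all $t\ge 0$, $f\in C_\kappa$ and defines a strongly continuous convex monotone semigroup on $C_\kappa$ with $S(t)0=0$. Constant. $\eta\colon\mathbb R_+\times\mathbb R^d\to\mathbb R_+$ is a fixed infinitely differentiable function with support in $[0,1]\times B_{\mathbb R^d}(1)$ and integral $1$, and $b_{0,1}:=\max_{|\alpha|=1}\|D^\alpha\eta\|_{L^1(\mathbb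 R_+\times\mathbb R^d)}$, where $D^\alpha$ acts in the space variable. *)

(* Defs.v *)
From HB Require Import structures.
From mathcomp Require Import all_boot all_order all_algebra.
From mathcomp Require Import all_classical all_reals all_analysis.

Set Implicit Arguments.
Unset Strict Implicit.
Unset Printing Implicit Defensive.
Import Order.TTheory GRing.Theory Num.Theory.
Import numFieldNormedType.Exports.
Local Open Scope classical_set_scope.
Local Open Scope ring_scope.

(* The library norm [`|x|] on ['rV[R]_d] is the sup norm, hence [enorm]. *)
Definition enorm (R : realType) (d : nat) (x : 'rV[R]_d) : R :=
  Num.sqrt (\sum_(i < d) x ord0 i ^+ 2).

(* Suprema of unbounded sets matter here, so norms take values in [\bar R]. *)
Definition supnorm (R : realType) (d : nat) (f : 'rV[R]_d -> R) : \bar R :=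
  ereal_sup [set (`|f x|)%:E | x in [set: 'rV[R]_d]].

Definition normk (R : realType) (d : nat) (kappa f : 'rV[R]_d -> R) : \bar R :=
  ereal_sup [set (`|f x| * kappa x)%:E | x in [set: 'rV[R]_d]].

Arguments normk {R d} (kappa f)%_ring_scope.

Record weight (R : realType) (d : nat) (kappa : 'rV[R]_d -> R) : Prop := {
  weight_continuous : continuous kappa ;
  weight_itv : forall x, 0 < kappa x <= 1 ;
  weight_ratio :
    (ereal_sup [set ereal_sup [set (kappa x / kappa (x - y))%:E
                              | y in [set y | (enorm y <= 1)%R]]
               | x in [set: 'rV[R]_d]] < +oo)%E }.

Definition Ckappa (R : realType) (d : nat) (kappa : 'rV[R]_d -> R) :
    set ('rV[R]_d -> R) :=
  [set f | continuous f /\ (normk kappa f < +oo)%E].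

Definition mixed_cvg (R : realType) (d : nat) (kappa : 'rV[R]_d -> R)
    (u : nat -> 'rV[R]_d -> R) (f : 'rV[R]_d -> R) : Prop :=
  [/\ forall n, Ckappa kappa (u n),
      Ckappa kappa f,
      (ereal_sup [set normk kappa (u n) | n in [set: nat]] < +oo)%E &
      {family compact, u @ \oo --> f}].

Definition Lipb (R : realType) (d : nat) (r : R) : set ('rV[R]_d -> R) :=
  [set f | (forall x y, `|f x - f y| <= r * enorm (x - y)) /\
           (supnorm f <= r%:E)%E].

(* [partials f [:: i1; ...; ik]] is the iterated partial derivative
   d_i1 (... (d_ik f)). *)
Definition partials (R : realType) (d : nat) (f : 'rV[R]_d -> R)
    (s : seq 'I_d) : 'rV[R]_d -> R :=
  foldr (fun i g => 'D_(delta_mx ord0 i : 'rV[R]_d) g) f s.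

(* ['D_v g] is total, so existence of each derivative is required explicitly. *)
Definition smooth (R : realType) (d : nat) (f : 'rV[R]_d -> R) : Prop :=
  forall s : seq 'I_d, continuous (partials f s) /\
    forall x i, derivable (partials f s) x (delta_mx ord0 i : 'rV[R]_d).

Definition Cbinf (R : realType) (d : nat) : set ('rV[R]_d -> R) :=
  [set f | smooth f /\
           forall s : seq 'I_d, (supnorm (partials f s) < +oo)%E].

(* Multi-indices with entries at most [l]: these include all those of degree
   [l]. *)
Definition mindex (d l : nat) := {ffun 'I_d -> 'I_l.+1}.

Definition mdegree (d l : nat) (a : mindex d l) : nat := (\sum_(i < d) a i)%N.

Definition mderiv (R : realType) (d l : nat) (a : mindex d l)
    (f : 'rV[R]_d -> R) : 'rV[R]_d -> R :=
  partials f (flatten [seq nseq (a i) i | i <- enum 'I_d]).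

Definition Dnorm (R : realType) (d l : nat) (f : 'rV[R]_d -> R) : \bar R :=
  supnorm (fun x => Num.sqrt
    (\sum_(a : mindex d l | mdegree a == l) mderiv a f x ^+ 2)).

Definition translate (R : realType) (d : nat) (x : 'rV[R]_d)
    (f : 'rV[R]_d -> R) : 'rV[R]_d -> R := fun y => f (x + y).

Definition kmax (R : realType) (h t : R) : nat := Num.truncn (t / h).

Lemma kmax_max (R : realType) (h t : R) (k : nat) : 0 < h -> 0 <= t ->
  (k <= kmax h t)%N = (k%:R * h <= t).
Proof.
by move=> h0 t0; rewrite truncn_ge_nat ?divr_ge0 ?(ltW h0)// ler_pdivlMr.
Qed.

Definition Ipi (R : realType) (d : nat)
    (I : R -> ('rV[R]_d -> R) -> ('rV[R]_d -> R)) (h : nat -> R)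
    (n : nat) (t : R) : ('rV[R]_d -> R) -> ('rV[R]_d -> R) :=
  iter (kmax (h n) t) (I (h n)).

(* The limit for h decreasing to 0 is taken along all positive null
   sequences. *)
Definition is_generator (R : realType) (d : nat) (kappa : 'rV[R]_d -> R)
    (I : R -> ('rV[R]_d -> R) -> ('rV[R]_d -> R))
    (f g : 'rV[R]_d -> R) : Prop :=
  forall u : nat -> R, (forall n, 0 < u n) -> u @ \oo --> (0 : R) ->
    mixed_cvg kappa (fun n x => (I (u n) f x - f x) / u n) g.

(* Operators on C_kappa are total maps on functions that preserve [Ckappa];
   their values outside [Ckappa kappa] are irrelevant. *)
Record admissible (R : realType) (d : nat) (kappa : 'rV[R]_d -> R)
    (h : nat -> R) (I : R -> ('rV[R]_d -> R) -> ('rV[R]_d -> R))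
    (omega t0 eps0 L : R) : Prop := {
  adm_step : forall n, 0 < h n <= 1 ;
  adm_step_cvg : h @ \oo --> (0 : R) ;
  adm_Ckappa : forall (t : R) f, 0 <= t -> Ckappa kappa f -> Ckappa kappa (I t f) ;
  adm_id : forall f, Ckappa kappa f -> I 0 f = f ;
  adm_convex : forall (t : R) f g (a : R), 0 <= t ->
    Ckappa kappa f -> Ckappa kappa g -> 0 <= a <= 1 ->
    forall x, I t (fun y => a * f y + (1 - a) * g y) x <=
              a * I t f x + (1 - a) * I t g x ;
  adm_monotone : forall (t : R) f g, 0 <= t ->
    Ckappa kappa f -> Ckappa kappa g -> (forall x, f x <= g x) ->
    forall x, I t f x <= I t g x ;
  adm_zero : forall t : R, 0 <= t -> I t (cst 0) = cst 0 ;
  adm_lipschitz : forall (t : R) f g, 0 <= t <= 1 ->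
    Ckappa kappa f -> Ckappa kappa g ->
    (normk kappa (I t f \- I t g) <=
     (expR (omega * t))%:E * normk kappa (f \- g))%E ;
  adm_translate : forall (t : R) x (r : R) f, 0 <= t <= t0 -> enorm x <= eps0 ->
    0 <= r -> Lipb r f ->
    (normk kappa (I t (translate x f) \- translate x (I t f)) <=
     (L * r * t * enorm x)%:E)%E ;
  adm_generator : forall f, Cbinf f ->
    (exists g, is_generator kappa I f g) /\
    exists c s0 : R, [/\ 0 <= c, 0 < s0 &
      forall t, 0 <= t <= s0 -> (normk kappa (I t f \- f) <= (c * t)%:E)%E] ;
  (* [K] is nonempty because [ereal_sup set0 = -oo]; for an empty [K] there is
     nothing to require. *)
  adm_continuous : forall (t : R) (K : set 'rV[R]_d)
      (f : nat -> 'rV[R]_d -> R),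
    0 <= t -> compact K -> K !=set0 ->
    (forall k, Ckappa kappa (f k)) ->
    (forall x, {homo f ^~ x : m n / (m <= n)%N >-> n <= m}) ->
    (forall x, f ^~ x @ \oo --> (0 : R)) ->
    let M (k : nat) : \bar R :=
      ereal_sup [set ereal_sup [set (Ipi I h n p.1 (f k) p.2)%:E
                               | n in [set: nat]]
                | p in [set s : R | 0 <= s <= t] `*` K] in
    {homo M : m n / (m <= n)%N >-> (n <= m)%E} /\ M @ \oo --> (0 : \bar R)%E ;
  adm_Lipb : forall (r t : R) f, 0 <= r -> 0 <= t -> Lipb r f ->
    Lipb (expR (omega * t) * r) (I t f) }.

Definition associated_semigroup (R : realType) (d : nat)
    (kappa : 'rV[R]_d -> R) (h : nat -> R)
    (I S : R -> ('rV[R]_d -> R) -> ('rV[R]_d -> R)) : Prop :=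
  forall (t : R) f, 0 <= t -> Ckappa kappa f ->
    mixed_cvg kappa (fun n => Ipi I h n t f) (S t f).

(* Lebesgue measure on R^n, carried by [n.-tuple R] (the library has no
   measurable structure on ['rV[R]_n]): iterated product of the
   one-dimensional Lebesgue measure. *)
Definition tcons (R : realType) (n : nat)
    (p : measurableTypeR R * n.-tuple (measurableTypeR R)) :
    n.+1.-tuple (measurableTypeR R) := [tuple of p.1 :: p.2].

Lemma measurable_tcons (R : realType) (n : nat) :
  measurable_fun setT (@tcons R n).
Proof. by apply: measurable_cons. Qed.

Definition tuncons (R : realType) (n : nat)
    (t : n.+1.-tuple (measurableTypeR R)) :
    measurableTypeR R * n.-tuple (measurableTypeR R) :=
  (thead t, [tuple of behead t]).

Lemma measurable_tuncons (R : realType) (n : nat) :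
  measurable_fun setT (@tuncons R n).
Proof.
apply/measurable_fun_pairP; split.
  exact: (@measurable_tnth _ (measurableTypeR R) n.+1 ord0).
exact: measurable_behead.
Qed.

Lemma tconsK (R : realType) (n : nat) : cancel (@tcons R n) (@tuncons R n).
Proof. by case=> x t; congr pair => //; apply/val_inj. Qed.

Lemma tunconsK (R : realType) (n : nat) : cancel (@tuncons R n) (@tcons R n).
Proof. by move=> t; rewrite [RHS]tuple_eta; apply/val_inj. Qed.

Section lebesgue_prod.
Context (R : realType) (n : nat)
  (mu : {sigma_finite_measure set (n.-tuple (measurableTypeR R)) -> \bar R}).
Local Open Scope ereal_scope.

Definition lebesgue_prod : set (n.+1.-tuple (measurableTypeR R)) -> \bar R :=
  pushforward (@lebesgue_measure R \x mu) (@tcons R n).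

Let m : {measure set (n.+1.-tuple (measurableTypeR R)) -> \bar R} :=
  measure_function_pushforward__canonical__measure_function_Measure
    (@lebesgue_measure R \x mu) (@measurable_tcons R n).

HB.instance Definition _ := isMeasure.Build _ _ _ lebesgue_prod
  (measure0 m) (measure_ge0 m) (@measure_semi_sigma_additive _ _ _ m).

Let lebesgue_prod_sigma_finite : sigma_finite setT lebesgue_prod.
Proof.
have /sigma_finiteP[F [TF ndF mF]] := sigma_finiteT (@lebesgue_measure R).
have /sigma_finiteP[G [TG ndG mG]] := sigma_finiteT mu.
exists (fun i => @tuncons R n @^-1` (F i `*` G i)).
  rewrite -preimage_bigcup; apply/esym; rewrite -subTset => t _ /=.
  have : setT (tuncons t).1 by [].
  rewrite TF => -[i _ Fi].
  have : setT (tuncons t).2 by [].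
  rewrite TG => -[j _ Gj].
  exists (maxn i j) => //; split.
    by move: Fi; exact/subsetPset/ndF/leq_maxl.
  by move: Gj; exact/subsetPset/ndG/leq_maxr.
move=> i; have [mFi Fioo] := mF i; have [mGi Gioo] := mG i; split.
  rewrite -[X in measurable X]setTI; apply: measurable_tuncons => //.
  exact: measurableX.
rewrite /lebesgue_prod /pushforward -comp_preimage.
rewrite (_ : _ \o _ = id) ?preimage_id; last by apply/funext; exact: tconsK.
by rewrite product_measure1E// lte_mul_pinfty// ge0_fin_numE.
Qed.

HB.instance Definition _ := Measure_isSigmaFinite.Build _ _ _ lebesgue_prod
  lebesgue_prod_sigma_finite.

End lebesgue_prod.

Fixpoint lebesgueN (R : realType) (n : nat) :
    {sigma_finite_measure set (n.-tuple (measurableTypeR R)) -> \bar R} :=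
  match n with
  | 0 => dirac ([tuple] : 0.-tuple (measurableTypeR R))
  | n'.+1 => lebesgue_prod (lebesgueN R n')
  end.

Definition row_of_tuple (R : realType) (n : nat)
    (t : n.-tuple (measurableTypeR R)) : 'rV[R]_n := \row_i tnth t i.

(* [eta t x] for [t >= 0] encodes a function on R_+ x R^d; its values for
   [t < 0] are irrelevant. Smoothness up to the boundary [t = 0] means that eta
   extends to a smooth function on R x R^d = R^(1 + d). *)
Record mollifier (R : realType) (d : nat) (eta : R -> 'rV[R]_d -> R) : Prop := {
  moll_ge0 : forall t x, 0 <= t -> 0 <= eta t x ;
  moll_smooth : exists2 g : 'rV[R]_(1 + d) -> R, smooth g &
    forall t x, 0 <= t -> eta t x = g (row_mx (const_mx t : 'rV[R]_1) x) ;
  moll_support :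
    closure [set z : R * 'rV[R]_d | 0 <= z.1 /\ eta z.1 z.2 != 0] `<=`
    [set z | 0 <= z.1 <= 1 /\ enorm z.2 <= 1] ;
  moll_int :
    (\int[(@lebesgue_measure R \x lebesgueN R d)]_(z in `[0%R, +oo[ `*` setT)
      (eta z.1 (row_of_tuple z.2))%:E = 1)%E }.

Definition b01 (R : realType) (d : nat) (eta : R -> 'rV[R]_d -> R) : R :=
  fine (\big[maxe/0]_(a : mindex d 1 | mdegree a == 1%N)
    \int[(@lebesgue_measure R \x lebesgueN R d)]_(z in `[0%R, +oo[ `*` setT)
      `|mderiv a (eta z.1) (row_of_tuple z.2)|%:E)%E.

(* Main.v *)
(** Mollify [f] with [eta] at scale [delta], integrating over time and space, to
    get [v]. Since [f] is [r]-Lipschitz, [|v - f| <= r * delta]; first partial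
    derivatives of [v] are at most [r], and putting one derivative on the kernel
    bounds the second ones by [b01 * r / delta]. The weights [d^(-1/2)] and
    [d^(-1)] absorb the number of multi-indices, so that
    [|I h v - v| <= rho1 (r, b01 * r / delta) * h]. Telescoping and the
    Lipschitz bound on [I h] control [I h ^ k v - I h ^ l v]; replacing [v] by
    [f] costs [r * delta] twice. The bound for the semigroup is the pointwise
    limit. *)
Require Import Defs.
From mathcomp Require Import all_boot all_order all_algebra.
From mathcomp Require Import all_classical all_reals all_analysis.
From mathcomp Require Import measurable_realfun.

Set Implicit Arguments.
Unset Strict Implicit.
Unset Printing Implicit Defensive.
Import Order.TTheory GRing.Theory Num.Theory.
Import numFieldNormedType.Exports.
Local Open Scope classical_set_scope.
Local Open Scope ring_scope.

(** * Translation invariance of Lebesgue measure, from the line to tuples *)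

(** Uniqueness of Lebesgue measure: the pushforward under the translation gives every interval []a,
    b]] its length. *)
Lemma lebesgue_measure_addl (R : realType) (c : R) (A : set R) :
  measurable A ->
  lebesgue_measure ((+%R c : _ -> measurableTypeR R) @^-1` A) =
  lebesgue_measure A.
Proof.
move=> mA.
have mc : measurable_fun setT (+%R c : measurableTypeR R -> measurableTypeR R).
  by apply: measurable_funD => //; exact: measurable_id.
apply/esym.
apply: (@lebesgue_measure_unique R
  (measure_function_pushforward__canonical__measure_function_Measure
     (@lebesgue_measure R) mc)) => //= _ [[a b]] _ <-.
rewrite /pushforward/=.
have -> : +%R c @^-1` `]a, b] = `]a - c, b - c]%classic.
  by apply/seteqP; split => x /=; rewrite !in_itv/= ltrBlDl lerBrDl.
rewrite !lebesgue_measure_itv/= !lte_fin ltrD2r -!EFinB.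
by case: ifP => // _; rewrite opprB addrA subrK.
Qed.

(** By uniqueness of the product measure only rectangles matter, and the preimage of a rectangle is
    the rectangle of the preimages. *)
Lemma product_measure_preserving d1 d2 (T1 : measurableType d1)
    (T2 : measurableType d2) (R : realType)
    (m1 : {sigma_finite_measure set T1 -> \bar R})
    (m2 : {sigma_finite_measure set T2 -> \bar R})
    (phi1 : T1 -> T1) (phi2 : T2 -> T2) :
  measurable_fun setT phi1 -> measurable_fun setT phi2 ->
  (forall A, measurable A -> m1 (phi1 @^-1` A) = m1 A) ->
  (forall A, measurable A -> m2 (phi2 @^-1` A) = m2 A) ->
  forall X : set (T1 * T2), measurable X ->
    (m1 \x m2)%E ((fun z => (phi1 z.1, phi2 z.2)) @^-1` X) = (m1 \x m2)%E X.
Proof.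
move=> mphi1 mphi2 p1 p2 X mX.
have mphi : measurable_fun setT (fun z : T1 * T2 => (phi1 z.1, phi2 z.2)).
  by apply: measurable_fun_pair; apply: measurableT_comp.
apply/esym; apply: (@product_measure_unique _ _ _ _ _ m1 m2
  (measure_function_pushforward__canonical__measure_function_Measure
     (m1 \x m2)%E mphi)) => //= A B mA mB.
rewrite /pushforward/=.
have -> : (fun z : T1 * T2 => (phi1 z.1, phi2 z.2)) @^-1` (A `*` B) =
    (phi1 @^-1` A) `*` (phi2 @^-1` B) by [].
rewrite product_measure1E.
- by congr (_ * _)%E; [exact: p1|exact: p2].
- by rewrite -[X in measurable X]setTI; exact: mphi1.
- by rewrite -[X in measurable X]setTI; exact: mphi2.
Qed.

Definition tshift (R : realType) (n : nat) (v : 'rV[R]_n)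
    (t : n.-tuple (measurableTypeR R)) : n.-tuple (measurableTypeR R) :=
  [tuple v ord0 i + tnth t i | i < n].

Lemma measurable_tshift (R : realType) (n : nat) (v : 'rV[R]_n) :
  measurable_fun setT (@tshift R n v).
Proof.
apply/measurable_fun_tnthP => i.
rewrite (_ : _ \o _ = fun t => v ord0 i + tnth t i); last first.
  by apply/funext => t /=; rewrite tnth_mktuple.
apply: measurable_funD => //.
exact: (@measurable_tnth _ (measurableTypeR R) n i).
Qed.

Lemma row_of_tuple_tshift (R : realType) (n : nat) (v : 'rV[R]_n) t :
  row_of_tuple (tshift v t) = v + row_of_tuple t.
Proof. by apply/rowP => i; rewrite !mxE tnth_mktuple. Qed.

(** Induction on the dimension: seen through [tcons], the shift translates the head and shifts the
    tail by the remaining coordinates of [v]. *)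
Lemma lebesgueN_tshift (R : realType) (n : nat) (v : 'rV[R]_n)
    (A : set (n.-tuple (measurableTypeR R))) : measurable A ->
  lebesgueN R n (tshift v @^-1` A) = lebesgueN R n A.
Proof.
elim: n => [|n IH] in v A *.
  move=> _; congr (lebesgueN R 0 _); apply/seteqP.
  by split=> t /=; rewrite (tuple0 (tshift v t)) (tuple0 t).
move=> mA; rewrite /= /lebesgue_prod /pushforward.
have mtA : measurable (@tcons R n @^-1` A).
  by rewrite -[X in measurable X]setTI; exact: measurable_tcons.
apply: (etrans _ (@product_measure_preserving _ _ _ _ _
  (@lebesgue_measure R) (lebesgueN R n) (+%R (v ord0 ord0))
  (tshift (\row_i v ord0 (lift ord0 i))) _ _ _ _ _ mtA)).
- congr ((_ \x _)%E _); apply/seteqP.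
  have E z : tshift v (tcons z) = tcons (v ord0 ord0 + z.1,
      tshift (\row_i v ord0 (lift ord0 i)) z.2).
    apply/eq_from_tnth => i; rewrite tnth_mktuple.
    case: (unliftP ord0 i) => [j|] ->; last by rewrite !(tnth_nth 0).
    by rewrite !tnthS tnth_mktuple mxE.
  by split => z /=; rewrite E.
- by apply: measurable_funD => //; exact: measurable_id.
- exact: measurable_tshift.
- exact: lebesgue_measure_addl.
- by move=> B mB; exact: IH.
Qed.

(** * Boxes, and measurability of continuous functions of a tuple *)

Lemma measurable_box (R : realType) (n : nat) (K : R) :
  measurable [set t : n.-tuple (measurableTypeR R) |
    forall i, `|tnth t i| <= K].
Proof.
rewrite (_ : [set _ | _] = \bigcap_(i in [set: 'I_n])
   ((fun t : n.-tuple (measurableTypeR R) => tnth t i) @^-1` `[- K, K])).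
  apply: fin_bigcap_measurable => // i _; rewrite -[X in measurable X]setTI.
  exact: (@measurable_tnth _ (measurableTypeR R) n i).
apply/seteqP; split => t /=.
  by move=> tK i _ /=; rewrite in_itv/= -ler_norml.
by move=> tK i; have := tK i I; rewrite /= in_itv/= -ler_norml.
Qed.

(** Multiples of box indicators are the dominating functions of all integrals below; this makes them
    integrable. Each dimension contributes one factor of finite length. *)
Lemma lebesgueN_box (R : realType) (n : nat) (K : R) :
  (lebesgueN R n [set t | forall i, (`|tnth t i| <= K)%R] < +oo)%E.
Proof.
elim: n => [|n IH].
  by rewrite /= diracE; case: (_ \in _); rewrite ltry.
rewrite /= /lebesgue_prod /pushforward.
set A := (X in (_ \x _)%E X).
have -> : A = `[- K, K]%classic `*` [set t | forall i, `|tnth t i| <= K].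
  apply/seteqP; split => -[a t]; rewrite /A/= => H.
    rewrite in_itv/= -ler_norml; split; first exact: (H ord0).
    by move=> i; have := H (lift ord0 i); rewrite tnthS.
  case: H => + H i; rewrite in_itv/= -ler_norml => aK.
  by case: (unliftP ord0 i) => [j|] ->; rewrite ?tnthS.
have Ioo : (lebesgue_measure ([set` `[- K, K]%R] : set R) < +oo)%E.
  by rewrite lebesgue_measure_itv/=; case: ifP => _; rewrite ltry.
rewrite product_measure1E//; last exact: measurable_box.
by apply: lte_mul_pinfty => //; rewrite ge0_fin_numE.
Qed.

(* ['rV[R]_n] carries no sigma-algebra in the library; an open set is covered by
   countably many rational boxes, whose preimages are measurable. *)
Lemma measurable_row_of_tuple (R : realType) (n : nat) (F : 'rV[R]_n -> R) :
  continuous F -> measurable_fun setT (F \o @row_of_tuple R n).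
Proof.
move=> cF; apply: (measurability _ (RGenOpens.measurableE R)) => //.
move=> _ [_ [a [b ->]] <-]; rewrite setTI.
pose U := F @^-1` `]a, b[.
have oU : open U by apply: open_comp => // x _; exact: cF.
(* [Q p] is the open cube with rational centre [p.1] and rational radius [p.2]; [V] collects the
   cubes that [F] maps into the interval. *)
pose Q (p : n.-tuple rat * rat) : set (n.-tuple (measurableTypeR R)) :=
  [set t | forall i, `|ratr (tnth p.1 i) - tnth t i| < ratr p.2].
pose V := [set p : n.-tuple rat * rat | Q p `<=` @row_of_tuple R n @^-1` U].
rewrite (_ : _ @^-1` _ = \bigcup_p (if p \in V then Q p else set0)).
  apply: countable_bigcupT_measurable => // p; case: ifP => // _.
  rewrite (_ : Q p = \bigcap_(i in [set: 'I_n])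
     ((fun t : n.-tuple (measurableTypeR R) => tnth t i) @^-1`
      ball (ratr (tnth p.1 i) : R) (ratr p.2))).
    apply: fin_bigcap_measurable => // i _; rewrite -[X in measurable X]setTI.
    apply: (@measurable_tnth _ (measurableTypeR R) n i) => //.
    exact: measurable_ball.
  by apply/seteqP; split => t /= H i => [_|]; apply: H.
rewrite -bigcup_mkcond.
apply/seteqP; split => [t /= Ut|t [p Vp Qpt]]; last exact: (Vp t Qpt).
have /nbhs_ballP[e /= e0 eU] : nbhs (row_of_tuple t) U by exact: open_nbhs_nbhs.
(* A cube of radius below [e / 2] whose centre is at most that far from [t] stays within distance
   [e] of [t]. *)
have [q] := @rat_in_itvoo R 0 (e / 2) (divr_gt0 e0 (ltr0Sn _ 1)).
rewrite in_itv/= => /andP[q0 qe].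
have hp i : exists s : rat, `|ratr s - tnth t i| < ratr q.
  have [] := @rat_in_itvoo R (tnth t i - ratr q) (tnth t i + ratr q).
    by rewrite ltrD2l gtrN.
  by move=> s; rewrite in_itv/= => st; exists s; rewrite ltr_distl.
have [s hs] := choice hp.
exists ([tuple s i | i < n], q).
  move=> t' /= Qt'; apply: eU; split => // j i; rewrite !mxE /ball/=.
  have := Qt' i; rewrite tnth_mktuple => h1; have h2 := hs i.
  rewrite -(subrKA (ratr (s i))) (le_lt_trans (ler_normD _ _))//.
  rewrite (splitr e) ltrD// ?(lt_trans h1)// distrC ?(lt_trans h2)//.
by move=> i; rewrite tnth_mktuple.
Qed.

(** * Kernels on the half-space: support, integrability, change of variables *)

Section kernels.
Context (R : realType) (d : nat).
Local Notation Z := (measurableTypeR R * d.-tuple (measurableTypeR R))%type.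
Local Notation mu := (@lebesgue_measure R \x lebesgueN R d)%E.

Definition halfspace : set Z := `[0, +oo[ `*` setT.

(** Time and space as one vector, the argument of the smooth extension in [moll_smooth]. *)
Definition zrow (z : Z) : 'rV[R]_(1 + d) :=
  row_mx (const_mx z.1 : 'rV_1) (row_of_tuple z.2).

Definition shiftz (v : 'rV[R]_d) (z : Z) :
  Z := (z.1, tshift v z.2).

Definition box (K : R) : set Z :=
  [set z | `|z.1| <= K /\ forall i, `|tnth z.2 i| <= K].

(* The values of [g] at negative times are arbitrary, as for [moll_smooth]. *)
Definition kernel_fun (g : 'rV[R]_(1 + d) -> R) : Prop :=
  smooth g /\ forall t x, 0 <= t ->
    g (row_mx (const_mx t : 'rV_1) x) != 0 -> t <= 1 /\ enorm x <= 1.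

Lemma measurable_halfspace : measurable halfspace.
Proof. exact: measurableX. Qed.

(** [zrow] is [row_of_tuple] in dimension [d.+1] after [tcons], so the result on tuples applies. *)
Lemma measurable_zrow (F : 'rV[R]_(1 + d) -> R) : continuous F ->
  measurable_fun setT (F \o zrow).
Proof.
move=> cF; rewrite (_ : F \o zrow = (F \o @row_of_tuple R d.+1) \o @tcons R d).
  exact: measurableT_comp (measurable_row_of_tuple cF) (@measurable_tcons R d).
apply/funext => z /=; congr F; apply/rowP => i; rewrite mxE.
case: (split_ordP i) => j ->; rewrite /zrow ?row_mxEl ?row_mxEr !mxE.
  by rewrite (_ : lshift d j = ord0)//; apply/val_inj; rewrite (ord1 j).
by rewrite (_ : rshift 1 j = lift ord0 j) ?tnthS//; apply/val_inj.
Qed.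

Lemma measurable_shiftz v : measurable_fun setT (shiftz v).
Proof.
apply: measurable_fun_pair => //.
by apply: measurableT_comp; first exact: measurable_tshift.
Qed.

Lemma shiftz_preserving v (A : set Z) :
  measurable A -> mu (shiftz v @^-1` A) = mu A.
Proof.
move=> mA; apply: (@product_measure_preserving _ _ _ _ _
  (@lebesgue_measure R) (lebesgueN R d) id (tshift v)) => //.
- exact: measurable_tshift.
- by move=> B mB; exact: lebesgueN_tshift.
Qed.

Lemma zrow_shiftz v z : zrow (shiftz v z) = row_mx 0 v + zrow z.
Proof.
rewrite /zrow /shiftz/= row_of_tuple_tshift.
by rewrite add_row_mx add0r.
Qed.

Lemma boxE K :
  box K = `[- K, K]%classic `*` [set t | forall i, `|tnth t i| <= K].
Proof.
by apply/seteqP; split => -[a t]; rewrite /box/= in_itv/= -ler_norml.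
Qed.

Lemma measurable_boxz K : measurable (box K).
Proof. by rewrite boxE; apply: measurableX => //; exact: measurable_box. Qed.

Lemma box_lty K : (mu (box K) < +oo)%E.
Proof.
have Ioo : (lebesgue_measure ([set` `[- K, K]%R] : set R) < +oo)%E.
  by rewrite lebesgue_measure_itv/=; case: ifP => _; rewrite ltry.
rewrite boxE product_measure1E//; last exact: measurable_box.
apply: lte_mul_pinfty => //; rewrite ?ge0_fin_numE//; exact: lebesgueN_box.
Qed.

Lemma integrable_box K M :
  mu.-integrable halfspace (EFin \o (fun z => M * \1_(box K) z)).
Proof.
apply: (@integrableS _ _ _ _ setT) => //; first exact: measurable_halfspace.
rewrite (_ : _ \o _ = fun z => (M%:E * (\1_(box K) z)%:E)%E); last first.
  by apply/funext => z; rewrite /= EFinM.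
apply: integrableZl => //.
apply/integrableP; split.
  by apply/measurable_EFinP; apply: measurable_indic; exact: measurable_boxz.
rewrite (eq_integral (fun z => (\1_(box K) z)%:E)).
  by rewrite integral_indic ?setIT//; [exact: box_lty|exact: measurable_boxz].
by move=> z _; rewrite gee0_abs// lee_fin.
Qed.

Lemma box_integrable (F : Z -> R) K M :
  measurable_fun setT F ->
  (forall z, halfspace z -> `|F z| <= M * \1_(box K) z) ->
  mu.-integrable halfspace (EFin \o F).
Proof.
move=> mF FM; apply: le_integrable (integrable_box K M).
- exact: measurable_halfspace.
- by apply/measurable_EFinP; exact: measurable_funTS.
- by move=> z /FM h; rewrite /= lee_fin (le_trans h)// ler_norm.
Qed.

Lemma enorm_coord n (x : 'rV[R]_n) (i : 'I_n) : `|x ord0 i| <= enorm x.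
Proof.
rewrite -sqrtr_sqr; apply: ler_wsqrtr; rewrite (bigD1 i)//= lerDl.
by apply: sumr_ge0 => j _; exact: sqr_ge0.
Qed.

Lemma kernel_box g z : kernel_fun g -> halfspace z -> g (zrow z) != 0 ->
  box 1 z.
Proof.
move=> [_ gs] [/=]; rewrite in_itv/= andbT => z0 _ /(gs _ _ z0)[z1 zB].
split; first by rewrite ger0_norm.
move=> i; have := le_trans (enorm_coord (row_of_tuple z.2) i) zB.
by rewrite mxE.
Qed.

(** [zrow] maps the unit box into the compact cube with sides [[-1, 1]], where [g] is bounded. *)
Lemma continuous_box_bounded (g : 'rV[R]_(1 + d) -> R) : continuous g ->
  exists2 M, 0 <= M & forall z, box 1 z -> `|g (zrow z)| <= M.
Proof.
move=> cg.
have : compact [set v : 'rV[R]_(1 + d) |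
    forall i, `[(-1 : R), 1]%classic (v ord0 i)].
  apply: (@rV_compact R _ (fun=> `[(-1 : R), 1]%classic)) => i.
  exact: segment_compact.
move/(continuous_compact (continuous_subspaceT cg))/compact_bounded.
move=> [M [_ hM]]; exists (`|M| + 1); first by rewrite addr_ge0.
move=> z [z1 z2]; apply: (hM (`|M| + 1)).
  by rewrite (le_lt_trans (ler_norm _))// ltrDl.
exists (zrow z) => // i; rewrite /= in_itv/= -ler_norml /zrow.
by case: (split_ordP i) => j ->; rewrite ?row_mxEl ?row_mxEr !mxE.
Qed.

Lemma kernel_bounded g : kernel_fun g ->
  exists2 M, 0 <= M & forall z, halfspace z -> `|g (zrow z)| <= M.
Proof.
move=> kg; have cg : continuous g by have [/(_ [::])[]] := kg.
have [M M0 hM] := continuous_box_bounded cg.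
exists M => // z hz; have [->|g0] := eqVneq (g (zrow z)) 0.
  by rewrite normr0.
by apply: hM; exact: kernel_box g0.
Qed.

Lemma shifted_kernel_box g v z : kernel_fun g -> halfspace z ->
  g (zrow (shiftz v z)) != 0 -> box (1 + enorm v) z.
Proof.
move=> kg hz /(@kernel_box _ (shiftz v z) kg hz)[/= z1 z2]; split.
  by rewrite (le_trans z1)// lerDl sqrtr_ge0.
move=> i; have := z2 i; rewrite tnth_mktuple => h.
rewrite -[tnth z.2 i](addKr (v ord0 i)) (le_trans (ler_normD _ _))//.
by rewrite normrN addrC lerD// enorm_coord.
Qed.

(** [K] is free so that one box can serve all shifts with [enorm v <= K - 1] at once, as
    differentiation under the integral requires. *)
Lemma shifted_kernel_dominated g (a : Z -> R) v B M z :
  kernel_fun g -> 0 <= B -> (forall z, `|a z| <= B) ->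
  (forall z, halfspace z -> `|g (zrow z)| <= M) -> halfspace z ->
  forall K, 1 + enorm v <= K ->
  `|a z * g (zrow (shiftz v z))| <= (B * M) * \1_(box K) z.
Proof.
move=> kg B0 aB gM hz K vK.
have hM : `|g (zrow (shiftz v z))| <= M by exact: (gM (shiftz v z)).
have M0 : 0 <= M by exact: le_trans hM.
have [->|g0] := eqVneq (g (zrow (shiftz v z))) 0.
  by rewrite mulr0 normr0 !mulr_ge0.
rewrite indicE mem_set ?mulr1 ?normrM; first exact: ler_pM.
have [z1 z2] := shifted_kernel_box kg hz g0.
by split => [|i]; rewrite (le_trans _ vK).
Qed.

Lemma measurable_shifted_kernel g (a : Z -> R) v :
  kernel_fun g -> measurable_fun setT a ->
  measurable_fun setT (fun z => a z * g (zrow (shiftz v z))).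
Proof.
move=> [sg _] ma; apply: measurable_funM => //.
have [cg _] := sg [::].
exact: (measurableT_comp (measurable_zrow cg) (measurable_shiftz v)).
Qed.

Lemma integrable_shifted_kernel g (a : Z -> R) v B :
  kernel_fun g -> measurable_fun setT a -> 0 <= B -> (forall z, `|a z| <= B) ->
  mu.-integrable halfspace (EFin \o (fun z => a z * g (zrow (shiftz v z)))).
Proof.
move=> kg ma B0 aB; have [M M0 gM] := kernel_bounded kg.
apply: (@box_integrable _ (1 + enorm v) (B * M)).
  exact: measurable_shifted_kernel.
by move=> z hz; apply: shifted_kernel_dominated.
Qed.

Lemma shiftz0 z : shiftz 0 z = z.
Proof.
case: z => t y; congr pair; apply: eq_from_tnth => i.
by rewrite tnth_mktuple mxE add0r.
Qed.

Lemma integrable_kernel g (a : Z -> R) B :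
  kernel_fun g -> measurable_fun setT a -> 0 <= B -> (forall z, `|a z| <= B) ->
  mu.-integrable halfspace (EFin \o (fun z => a z * g (zrow z))).
Proof.
move=> kg ma B0 aB; have := integrable_shifted_kernel 0 kg ma B0 aB.
by under eq_fun do rewrite shiftz0.
Qed.

Definition L1norm (g : 'rV[R]_(1 + d) -> R) : R :=
  \int[mu]_(z in halfspace) `|g (zrow z)|.

Lemma kernel_integrable g : kernel_fun g ->
  mu.-integrable halfspace (EFin \o (fun z => g (zrow z))).
Proof.
move=> kg; have n1 (z : Z) : `|cst (1 : R) z| <= 1 by rewrite normr1.
have := integrable_kernel kg (measurable_cst (1 : R)) ler01 n1.
by under eq_fun do rewrite mul1r.
Qed.

Lemma integrable_kernel_norm g : kernel_fun g ->
  mu.-integrable halfspace (EFin \o (fun z => `|g (zrow z)|)).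
Proof. by move/kernel_integrable/integrable_norm. Qed.

(** The two bounds on [a] have different roles: [B] holds everywhere and secures integrability,
    while [C] is asked for only where the kernel is nonzero and is the one in the estimate. *)
Lemma le_normr_kernel_integral g (a : Z -> R) B C :
  kernel_fun g -> measurable_fun setT a -> 0 <= B -> (forall z, `|a z| <= B) ->
  (forall z, halfspace z -> g (zrow z) != 0 -> `|a z| <= C) ->
  `|\int[mu]_(z in halfspace) (a z * g (zrow z))| <= C * L1norm g.
Proof.
move=> kg ma B0 aB aC; have mh := @measurable_halfspace.
have ig := integrable_kernel kg ma B0 aB.
apply: le_trans (le_normr_Rintegral mh ig) _.
rewrite -RintegralZl//; last exact: integrable_kernel_norm.
apply: le_Rintegral => //.
- exact: integrable_norm.
- rewrite (_ : _ \o _ = fun z => (C%:E * (`|g (zrow z)|)%:E)%E).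
    by apply: integrableZl => //; exact: integrable_kernel_norm.
  by apply/funext => z /=; rewrite EFinM.
move=> z hz; have [->|g0] := eqVneq (g (zrow z)) 0.
  by rewrite mulr0 normr0 mulr0.
by rewrite normrM ler_wpM2r//; exact: aC.
Qed.

(** [shiftz v] preserves the measure, and it leaves time alone, so the half-space is its own
    preimage. *)
Lemma Rintegral_shiftz v (F : Z -> R) :
  measurable_fun setT F ->
  mu.-integrable halfspace (EFin \o (F \o shiftz v)) ->
  \int[mu]_(z in halfspace) F z = \int[mu]_(z in halfspace) F (shiftz v z).
Proof.
move=> mF iF; congr fine.
have mEF : measurable_fun setT (EFin \o F) by exact/measurable_EFinP.
apply: (etrans _ (@integral_pushforward _ _ _ _ _ (shiftz v)
  (measurable_shiftz v) mu halfspace (EFin \o F) mEF iF measurable_halfspace)).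
apply: (eq_measure_integral
  (measure_function_pushforward__canonical__measure_function_Measure
    mu (measurable_shiftz v))) => A mA _.
exact: (esym (shiftz_preserving v mA)).
Qed.

End kernels.

(** * Euclidean norm and Lipschitz functions *)

Section enorm_theory.
Context (R : realType) (n : nat).
Implicit Types x : 'rV[R]_n.

Lemma enormZ (c : R) x : enorm (c *: x) = `|c| * enorm x.
Proof.
rewrite /enorm -sqrtr_sqr -sqrtrM ?sqr_ge0// mulr_sumr.
by congr Num.sqrt; apply: eq_bigr => i _; rewrite !mxE exprMn.
Qed.

Lemma enorm_delta (i : 'I_n) : enorm (delta_mx ord0 i : 'rV[R]_n) = 1.
Proof.
rewrite /enorm (bigD1 i)//= big1 ?addr0.
  by rewrite mxE !eqxx expr1n sqrtr1.
by move=> j ji; rewrite mxE (negbTE ji) andbF expr0n.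
Qed.

Lemma enorm_continuous : continuous (@enorm R n).
Proof.
move=> x; apply: (@continuous_comp _ _ _
  (fun x : 'rV[R]_n => \sum_(i < n) x ord0 i ^+ 2) Num.sqrt).
  apply: continuous_big; [exact: add_continuous|move=> i _ y].
  apply: (@continuous_comp _ _ _ (fun x : 'rV[R]_n => x ord0 i)
    (fun a => a ^+ 2)).
    exact: coord_continuous.
  exact: exprn_continuous.
exact: sqrt_continuous.
Qed.

End enorm_theory.

Lemma Lipb_bounded (R : realType) (n : nat) (r : R) (f : 'rV[R]_n -> R) x :
  Lipb r f -> `|f x| <= r.
Proof.
case=> _; rewrite /supnorm => h; rewrite -lee_fin.
by apply: le_trans h; apply: ereal_sup_ubound; exists x.
Qed.

(** The topology of ['rV[R]_n] comes from the sup norm, so the argument passes through the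
    continuity of [enorm]. *)
Lemma lipschitz_continuous (R : realType) (n : nat) (C : R)
    (g : 'rV[R]_n -> R) :
  (forall x y, `|g x - g y| <= C * enorm (x - y)) -> continuous g.
Proof.
move=> gL x; apply/(@cvgrPdist_le _ _ _ (nbhs x)) => e e0.
pose F (y : 'rV[R]_n) : R := C * enorm (x - y).
have cF : {for x, continuous F}.
  apply: (@continuous_comp _ _ _ (fun y : 'rV[R]_n => x - y)
    (fun v => C * enorm v)).
    apply: continuousB; last exact: cvg_id.
    exact: cst_continuous.
  apply: continuousM; last exact: enorm_continuous.
  exact: cst_continuous.
have F0 : F x < e.
  rewrite /F (_ : x - x = 0 *: (0 : 'rV[R]_n)) ?enormZ ?normr0 ?mul0r ?mulr0//.
  by rewrite scale0r; exact: subrr.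
near=> y; apply: le_trans (gL x y) _; rewrite -/(F y).
by near: y; exact: (cvgr_le (F x) cF).
Unshelve. all: by end_near. Qed.

(** * Space derivatives of kernels and derivatives along lines *)

Lemma row_mx0_delta (R : realType) (d : nat) (i : 'I_d) :
  row_mx (0 : 'rV_1) (delta_mx ord0 i) =
  delta_mx ord0 (rshift 1 i) :> 'rV[R]_(1 + d).
Proof.
apply/rowP => j; case: (split_ordP j) => k ->.
  by rewrite row_mxEl !mxE eq_shift andbF.
by rewrite row_mxEr !mxE eq_shift.
Qed.

Lemma add_scale_row_mx (R : realType) (d : nat) (i : 'I_d) (h t : R)
    (x : 'rV[R]_d) :
  h *: delta_mx ord0 (rshift 1 i) + row_mx (const_mx t : 'rV_1) x =
  row_mx (const_mx t : 'rV_1) (h *: delta_mx ord0 i + x) :> 'rV[R]_(1 + d).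
Proof.
by rewrite -row_mx0_delta scale_row_mx scaler0 add_row_mx add0r.
Qed.

(** The complement of the closed ball is open and time stays fixed along a space direction, so [g]
    vanishes on a short segment around any point outside the support, and its derivative there is
    0. *)
Lemma kernel_fun_derive (R : realType) (d : nat) (g : 'rV[R]_(1 + d) -> R)
    (i : 'I_d) :
  kernel_fun g ->
  kernel_fun ('D_(delta_mx ord0 (rshift 1 i) : 'rV[R]_(1 + d)) g).
Proof.
move=> [sg gs]; split.
  (* The new derivative acts on [g] first, hence it is the last entry of the list. *)
  move=> s; have := sg (rcons s (rshift 1 i)).
  by rewrite /partials foldr_rcons.
move=> t x t0 Dg.
have [//|nt] := pselect (t <= 1 /\ enorm x <= 1).
suff E : 'D_(delta_mx ord0 (rshift 1 i) : 'rV[R]_(1 + d)) g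
    (row_mx (const_mx t : 'rV_1) x) = 0 by rewrite E eqxx in Dg.
have g0 y : ~ (t <= 1 /\ enorm y <= 1) -> g (row_mx (const_mx t : 'rV_1) y) = 0.
  by move=> h; apply/eqP; apply/negPn/negP => /(gs _ _ t0).
have nz : \forall h \near (0 : R),
    ~ (t <= 1 /\ enorm (h *: delta_mx ord0 i + x) <= 1).
  have [t1|t1] := leP t 1; last first.
    by near=> h; case.
  have x1 : 1 < enorm x by rewrite ltNge; apply/negP => ?; exact: nt.
  have cE : {for 0, continuous (fun h : R =>
      enorm (h *: (delta_mx ord0 i : 'rV[R]_d) + x))}.
    apply: (@continuous_comp _ _ _
      (fun h : R => h *: (delta_mx ord0 i : 'rV[R]_d) + x) (@enorm R d)).
      apply: continuousD; last exact: cst_continuous.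
      exact: scalel_continuous.
    exact: enorm_continuous.
  near=> h => -[_]; apply/negP; rewrite -ltNge.
  near: h; apply: (cvgr_gt _ cE).
  by rewrite /= scale0r add0r.
rewrite /derive; apply: cvg_lim => //; apply: cvg_near_cst.
near=> h; rewrite /= add_scale_row_mx !g0 ?subrr ?scaler0//.
by near: h; exact: nbhs_dnbhs nz.
Unshelve. all: by end_near. Qed.

Lemma is_derive_line (R : realType) (V : normedModType R) (g : V -> R) (p e : V)
    (v : R) : derivable g (v *: e + p) e ->
  is_derive v 1 (fun u => g (u *: e + p)) ('D_e g (v *: e + p)).
Proof.
move=> dg.
have E : (fun h : R => h^-1 *: (((fun u => g (u *: e + p)) \o shift v) (h *: 1)
      - g (v *: e + p))) =
    (fun h : R => h^-1 *:
      ((g \o shift (v *: e + p)) (h *: e) - g (v *: e + p))).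
  by apply/funext => h /=; rewrite [h *: 1]mulr1 scalerDl addrA.
by apply: DeriveDef; rewrite /derivable /derive E.
Qed.

(** Reduces a directional derivative to a one-variable derivative at 0, the form that
    differentiation under the integral delivers. *)
Lemma is_derive_of_line (R : realType) (V : normedModType R) (g : V -> R)
    (x e : V) (c : R) :
  is_derive (0 : R) 1 (fun h => g (h *: e + x)) c -> is_derive x e g c.
Proof.
move=> [dg <-]; apply: (@DeriveDef _ _ _ x e g); first exact/derivable1P.
rewrite /derive -[X in lim (X @ _) = _](_ : (fun h : R => h^-1 *:
  (((fun h => g (h *: e + x)) \o shift 0) (h *: 1) - g (0 *: e + x))) = _)//.
by apply/funext => h /=; rewrite [h *: 1]mulr1 addr0 scale0r add0r.
Qed.

(** * The mollification and its first derivatives *)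

Section mollification.
Context (R : realType) (d : nat) (r delta : R) (f : 'rV[R]_d -> R).
Hypotheses (r0 : 0 <= r) (fL : Lipb r f).
Local Notation mu := (@lebesgue_measure R \x lebesgueN R d)%E.

Local Notation Z := (measurableTypeR R * d.-tuple (measurableTypeR R))%type.

(** Convolution of [f] with the kernel rescaled to width [delta], written after the substitution
    that moves the scale into the argument of [f]. As [f] does not depend on time, time is merely
    integrated out. *)
Definition mollify (g : 'rV[R]_(1 + d) -> R) (x : 'rV[R]_d) : R :=
  \int[mu]_(z in @halfspace R d)
    (f (x - delta *: row_of_tuple z.2) * g (zrow z)).

Let cf : continuous f.
Proof. by have [h _] := fL; exact: lipschitz_continuous h. Qed.

Lemma measurable_mollify_factor x :
  measurable_fun setT (fun z : Z =>
    f (x - delta *: row_of_tuple z.2)).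
Proof.
have c : continuous (fun y : 'rV[R]_d => f (x - delta *: y)).
  move=> y.
  apply: (@continuous_comp _ _ _ (fun y : 'rV[R]_d => x - delta *: y) f).
    apply: continuousB; first exact: cst_continuous.
    exact: scaler_continuous.
  exact: cf.
exact: measurableT_comp (measurable_row_of_tuple c) measurable_snd.
Qed.

(** The scaled integration variable cancels in the difference of the two arguments of [f]. The
    kernel may change sign, so the bound also applies to derivatives of kernels. *)
Lemma mollify_lipschitz g x y : kernel_fun g ->
  `|mollify g x - mollify g y| <= r * L1norm g * enorm (x - y).
Proof.
move=> kg; have fB y := Lipb_bounded y fL.
have mh := @measurable_halfspace R d.
rewrite -RintegralB//; first last.
- exact: (integrable_kernel kg (measurable_mollify_factor y) r0).
- exact: (integrable_kernel kg (measurable_mollify_factor x) r0).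
under eq_Rintegral do rewrite -mulrBl.
rewrite mulrAC.
apply: (@le_normr_kernel_integral _ _ _ _ (r + r)) => //.
- by apply: measurable_funB; exact: measurable_mollify_factor.
- exact: addr_ge0.
- by move=> z; rewrite (le_trans (ler_normB _ _))// lerD.
- move=> z _ _; have [h _] := fL; rewrite (le_trans (h _ _))//.
  by rewrite opprB addrA subrK.
Qed.

Lemma mollify_bounded g x : kernel_fun g -> `|mollify g x| <= r * L1norm g.
Proof.
move=> kg; apply: (@le_normr_kernel_integral _ _ _ _ r) => //.
- exact: measurable_mollify_factor.
- by move=> z; exact: Lipb_bounded.
- by move=> z _ _; exact: Lipb_bounded.
Qed.

(** Substituting [shiftz v] cancels [delta *: v] inside [f]. *)
Lemma mollify_translate g x v : kernel_fun g ->
  mollify g (delta *: v + x) =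
  \int[mu]_(z in @halfspace R d)
    (f (x - delta *: row_of_tuple z.2) * g (zrow (shiftz v z))).
Proof.
move=> kg; rewrite /mollify (Rintegral_shiftz (v := v)).
- apply: eq_Rintegral => z _; congr (f _ * _).
  by rewrite row_of_tuple_tshift scalerDr opprD addrACA subrr add0r.
- apply: measurable_funM; first exact: measurable_mollify_factor.
  by apply: measurable_zrow; have [/(_ [::])[]] := kg.
have := integrable_shifted_kernel v kg (measurable_mollify_factor x) r0
  (fun z => Lipb_bounded _ fL).
congr (mu.-integrable _ _); apply/funext => z /=; congr (f _ * _)%:E.
by rewrite row_of_tuple_tshift scalerDr opprD addrACA subrr add0r.
Qed.

(* Translation invariance moves the increment of the argument from [f], which is
   only Lipschitz, to the kernel. *)
Lemma mollify_is_derive g x (i : 'I_d) : 0 < delta -> kernel_fun g ->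
  is_derive x (delta_mx ord0 i : 'rV[R]_d) (mollify g)
    (delta^-1 * mollify ('D_(delta_mx ord0 (rshift 1 i) : 'rV[R]_(1 + d)) g) x).
Proof.
move=> delta0 kg; pose e : 'rV[R]_d := delta_mx ord0 i.
pose E : 'rV[R]_(1 + d) := delta_mx ord0 (rshift 1 i).
have kDg : kernel_fun ('D_E g) by exact: kernel_fun_derive.
pose a (z : Z) :=
  f (x - delta *: row_of_tuple z.2).
have ma : measurable_fun setT a by exact: measurable_mollify_factor.
have aB (z : Z) : `|a z| <= r by exact: Lipb_bounded.
(* The factor [a] is frozen; the parameter [v] acts on the smooth kernel only. *)
pose F (v : R) (z : Z) := a z * g (zrow (shiftz (v *: e) z)).
have zE v (z : Z) : zrow (shiftz (v *: e) z) = v *: E + zrow z.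
  by rewrite zrow_shiftz /E -row_mx0_delta scale_row_mx scaler0.
have dF (v : R) (z : Z) :
    is_derive v 1 (F ^~ z) (a z * 'D_E g (zrow (shiftz (v *: e) z))).
  rewrite (_ : F ^~ z = fun u => a z * g (u *: E + zrow z)); last first.
    by apply/funext => u; rewrite /F zE.
  rewrite zE; apply: is_deriveZ; apply: is_derive_line.
  by have [sg _] := kg; have [_] := sg [::]; exact.
have [M M0 gM] := kernel_bounded kDg.
have d1F v (z : Z) :
    partial1of2 F v z = a z * 'D_E g (zrow (shiftz (v *: e) z)).
  by rewrite partial1of2E; exact: derive_val.
(* Dominates the derivatives for all parameters in []-1, 1[]: a shift shorter than 1 keeps the
   support inside the box of size 2. *)
pose G (z : Z) := (r * M) * \1_(@box R d 2) z.
have dPhi : is_derive (0 : R) 1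
    (fun v => \int[mu]_(z in @halfspace R d) F v z) (mollify ('D_E g) x).
  have I0 : [set` `]-1, (1 : R)[] 0 by rewrite /= in_itv/= ltrN10 ltr01.
  have c := @cvg_differentiation_under_integral R _ _ mu F _
    (@measurable_halfspace R d) 0 (-1) 1 I0 _ _ G _ _ _.
  have {}c : h^-1 *: ((\int[mu]_(z in @halfspace R d) F (h + 0) z) -
      \int[mu]_(z in @halfspace R d) F 0 z) @[h --> (0 : R)^'] -->
      mollify ('D_E g) x.
    rewrite (_ : mollify _ x =
        \int[mu]_(z in @halfspace R d) partial1of2 F 0 z).
      apply: c.
    - by move=> v _; exact: (integrable_shifted_kernel (v *: e) kg ma r0 aB).
    - by move=> v z _ _; exact: ex_derive.
    - by move=> z; rewrite !mulr_ge0.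
    - exact: integrable_box.
    - move=> v z; rewrite /= in_itv/= => /andP[v1 v2] hz.
      rewrite d1F; apply: (shifted_kernel_dominated kDg r0 aB gM hz).
      rewrite enormZ enorm_delta mulr1 -[2]/(1 + 1) lerD2l.
      by rewrite ler_norml !ltW.
    by apply: eq_Rintegral => z _; rewrite d1F zE scale0r add0r.
  have Q : (fun h : R => h^-1 *:
      (((fun v => \int[mu]_(z in @halfspace R d) F v z) \o shift 0) (h *: 1) -
      \int[mu]_(z in @halfspace R d) F 0 z)) =
      (fun h : R => h^-1 *: ((\int[mu]_(z in @halfspace R d) F (h + 0) z) -
      \int[mu]_(z in @halfspace R d) F 0 z)).
    by apply/funext => h /=; rewrite [h *: 1]mulr1.
  apply: DeriveDef; rewrite /derivable /derive Q; last exact: cvg_lim c.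
  by apply/cvg_ex; exists (mollify ('D_E g) x).
apply: is_derive_of_line.
(* Moving the point by [h] shifts the kernel by [delta^-1 * h]; the chain rule yields the factor
   [delta^-1]. *)
rewrite (_ : (fun h => _) = (fun v => \int[mu]_(z in @halfspace R d) F v z) \o
    (fun h : R => delta^-1 * h)).
  rewrite mulrC; apply: is_derive1_comp.
    by rewrite mulr0.
  by rewrite -[X in is_derive _ _ _ X]mulr1; exact: is_deriveZ.
apply/funext => h /=; rewrite -/e -(mollify_translate _ _ kg).
congr (mollify g (_ + x)).
by rewrite scalerA mulrA divff ?mul1r// gt_eqF.
Qed.

End mollification.

(** * Smoothness, derivative bounds and accuracy of the mollification *)

Lemma supnorm_le (R : realType) (d : nat) (F : 'rV[R]_d -> R) (M : R) :
  (forall x, `|F x| <= M) -> (supnorm F <= M%:E)%E.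
Proof. by move=> FM; apply: ge_ereal_sup => _ [x _ <-]; rewrite lee_fin. Qed.

(** Every difference quotient along a unit vector is at most [C] in absolute value, hence so is the
    limit. *)
Lemma lipschitz_derive_le (R : realType) (d : nat) (F : 'rV[R]_d -> R) (C : R)
    (x : 'rV[R]_d) (i : 'I_d) (l : R) :
  (forall x y, `|F x - F y| <= C * enorm (x - y)) ->
  is_derive x (delta_mx ord0 i : 'rV[R]_d) F l -> `|l| <= C.
Proof.
move=> FL [dF <-]; rewrite /derive -lim_norm//.
apply: limr_le; first exact: is_cvg_norm.
near=> h.
have h0 : h != 0 by near: h; exact: nbhs_dnbhs_neq.
rewrite /= normrM normfV ler_pdivrMl ?normr_gt0// (le_trans (FL _ _))//.
by rewrite addrK enormZ enorm_delta mulr1 mulrC.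
Unshelve. all: by end_near. Qed.

Section mollify_smooth.
Context (R : realType) (d : nat) (r delta : R) (f : 'rV[R]_d -> R).
Hypotheses (r0 : 0 <= r) (fL : Lipb r f) (delta0 : 0 < delta).

Lemma kernel_fun_partials (g : 'rV[R]_(1 + d) -> R) (s : seq 'I_d) :
  kernel_fun g -> kernel_fun (partials g [seq rshift 1 i | i <- s]).
Proof. by move=> kg; elim: s => //= i s IH; exact: kernel_fun_derive. Qed.

(** Each derivative falls on the kernel at the price of one factor [delta^-1]. *)
Lemma partials_mollify (g : 'rV[R]_(1 + d) -> R) (s : seq 'I_d) :
  kernel_fun g ->
  partials (mollify delta f g) s = delta^-1 ^+ size s \*:
    mollify delta f (partials g [seq rshift 1 i | i <- s]).
Proof.
move=> kg; elim: s => [|i s IH]; first by apply/funext => x /=; rewrite scale1r.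
rewrite [LHS]/= -/(partials _ _) IH; apply/funext => x.
have := mollify_is_derive r0 fL x i delta0 (kernel_fun_partials s kg).
move/(is_deriveZ (delta^-1 ^+ size s)) => D.
by rewrite (@derive_val _ _ _ _ _ _ _ D) /= exprSr scalerA.
Qed.

(** Every iterated derivative is a multiple of a mollification by another kernel, hence Lipschitz,
    differentiable and bounded. *)
Lemma Cbinf_mollify (g : 'rV[R]_(1 + d) -> R) : kernel_fun g ->
  Cbinf (mollify delta f g).
Proof.
move=> kg; split=> s; rewrite partials_mollify//.
  have kgs := kernel_fun_partials s kg; split.
    move=> x; apply: continuousZl_tmp.
    apply: lipschitz_continuous => y z.
    exact: (mollify_lipschitz delta r0 fL y z kgs).
  move=> x i; apply: derivableZ.
  by have [] := mollify_is_derive r0 fL x i delta0 kgs.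
apply: le_lt_trans (supnorm_le (M := delta^-1 ^+ size s *
   (r * L1norm (partials g [seq rshift 1 i | i <- s]))) _) (ltry _) => x.
rewrite /= normrM ger0_norm ?exprn_ge0 ?invr_ge0 ?(ltW delta0)//.
rewrite ler_wpM2l ?exprn_ge0 ?invr_ge0 ?(ltW delta0)//.
exact: (mollify_bounded delta r0 fL x (kernel_fun_partials s kg)).
Qed.

(** Read off from the Lipschitz constant of the mollification; no derivative reaches the kernel, so
    no power of [delta] appears. *)
Lemma partials_mollify1_le (g : 'rV[R]_(1 + d) -> R) (i : 'I_d) x :
  kernel_fun g -> `|partials (mollify delta f g) [:: i] x| <= r * L1norm g.
Proof.
move=> kg; have [sc _] := Cbinf_mollify kg; have [_ dc] := sc [::].
apply: (@lipschitz_derive_le _ _ (mollify delta f g) _ x i).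
  by move=> y z; exact: (mollify_lipschitz delta r0 fL y z kg).
exact: DeriveDef (dc x i) erefl.
Qed.

(** Only the inner derivative goes to the kernel. The outer one is bounded by the Lipschitz constant
    of what results, which keeps the cost at a single [delta^-1]. *)
Lemma partials_mollify2_le (g : 'rV[R]_(1 + d) -> R) (i j : 'I_d) x :
  kernel_fun g -> `|partials (mollify delta f g) [:: i; j] x| <=
  delta^-1 * (r * L1norm ('D_(delta_mx ord0 (rshift 1 j) : 'rV[R]_(1 + d)) g)).
Proof.
move=> kg; have [sc _] := Cbinf_mollify kg; have [_ dc] := sc [:: j].
apply: (@lipschitz_derive_le _ _ (partials (mollify delta f g) [:: j]) _ x i).
  move=> y z; rewrite partials_mollify//= expr1 -mulrBr normrM.
  rewrite ger0_norm ?invr_ge0 ?(ltW delta0)// -mulrA.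
  rewrite ler_wpM2l ?invr_ge0 ?(ltW delta0)//.
  exact: (mollify_lipschitz delta r0 fL y z (kernel_fun_derive j kg)).
exact: DeriveDef (dc x i) erefl.
Qed.

Lemma mollify_dist_le (g : 'rV[R]_(1 + d) -> R) x : kernel_fun g ->
  (forall z, @halfspace R d z -> 0 <= g (zrow z)) -> L1norm g = 1 ->
  `|mollify delta f g x - f x| <= r * delta.
Proof.
move=> kg g0 g1; have fB y := Lipb_bounded y fL.
have mh := @measurable_halfspace R d.
have ig := integrable_kernel kg (measurable_mollify_factor delta fL x) r0
  (fun z => fB _).
have ic := integrable_kernel kg (measurable_cst (f x)) r0 (fun=> fB _).
(* The kernel has mass 1, so [f x] is itself an integral against it and the two integrals can be
   subtracted. *)
have E : f x = \int[(@lebesgue_measure R \x lebesgueN R d)%E]_(z in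
    @halfspace R d) (f x * g (zrow z)).
  rewrite RintegralZl//; last exact: kernel_integrable.
  rewrite -[LHS]mulr1 -g1; congr (_ * _).
  by apply: eq_Rintegral => z; rewrite inE => /g0 /ger0_norm.
rewrite [X in _ - X]E /mollify -RintegralB//.
under eq_Rintegral do rewrite -mulrBl.
rewrite -[leRHS]mulr1 -[in leRHS]g1.
apply: (@le_normr_kernel_integral _ _ _ _ (r + r)) => //.
- apply: measurable_funB; last exact: measurable_cst.
  exact: (measurable_mollify_factor delta fL x).
- exact: addr_ge0.
- by move=> z; rewrite (le_trans (ler_normB _ _))// lerD.
- move=> z hz gz; have [h _] := fL; rewrite (le_trans (h _ _))//.
  rewrite addrAC subrr add0r -scaleNr enormZ normrN.
  rewrite ger0_norm ?ler_wpM2l ?(ltW delta0)//.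
  (* On the support of the kernel the space variable has norm at most 1, so [f] is evaluated within
     [delta] of [x]. *)
  have [_ gs] := kg; have := hz; rewrite /halfspace/= in_itv/= andbT => -[z0 _].
  by have [_ h1] := gs _ _ z0 gz; rewrite -[leRHS]mulr1 ler_wpM2l// ltW.
Qed.

End mollify_smooth.

(** * Counting multi-indices and bounding [Dnorm] *)

Section multi_indices.
Context (d : nat).

(** The directions along which [mderiv] differentiates; it carries bounds on [partials] over to
    [mderiv]. *)
Definition mword (l : nat) (a : mindex d l) : seq 'I_d :=
  flatten [seq nseq (a i) i | i <- enum 'I_d].

Lemma size_mword (l : nat) (a : mindex d l) : size (mword a) = mdegree a.
Proof.
rewrite size_flatten /shape -map_comp sumnE big_map big_enum/=.
by apply: eq_bigr => i _; rewrite /= size_nseq.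
Qed.

Lemma count_mword (l : nat) (a : mindex d l) (i : 'I_d) :
  count_mem i (mword a) = a i.
Proof.
rewrite count_flatten -map_comp sumnE big_map big_enum/= (bigD1 i)//=.
rewrite count_nseq /= eqxx mul1n big1 ?addn0// => j ji.
by rewrite count_nseq /= (negbTE ji).
Qed.

(** Multi-indices of degree [l] inject into words of length [l], since counting letters recovers the
    multi-index. *)
Lemma card_mdegree (l : nat) : (0 < d)%N ->
  (#|[pred a : mindex d l | mdegree a == l]| <= d ^ l)%N.
Proof.
(* The default letter is never read in degree [l], where the word has exactly [l] letters. *)
move=> d0; pose w (a : mindex d l) : l.-tuple 'I_d :=
  [tuple nth (Ordinal d0) (mword a) k | k < l].
have wE a : mdegree a == l -> w a = mword a :> seq _.
  move=> /eqP al; apply: (@eq_from_nth _ (Ordinal d0)).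
    by rewrite size_tuple size_mword al.
  move=> k; rewrite size_tuple => kl.
  by rewrite -[k]/(val (Ordinal kl)) -tnth_nth tnth_mktuple.
rewrite -[d in (d ^ l)%N]card_ord -card_tuple.
rewrite -(card_in_imset (f := w) (D := [pred a : mindex d l | mdegree a == l])).
  exact: max_card.
move=> a b; rewrite !inE => al bl /(congr1 val)/=; rewrite !wE// => ab.
by apply/ffunP => i; apply/val_inj; rewrite /= -!count_mword ab.
Qed.

Definition munit (i : 'I_d) : mindex d 1 :=
  [ffun j => if j == i then ord_max else ord0].

Lemma mword_munit (i : 'I_d) : mword (munit i) = [:: i].
Proof.
rewrite /mword (_ : [seq _ | _ <- _] = [seq nseq (j == i) j | j <- enum 'I_d]).
  rewrite -(filter_pred1_uniq (enum_uniq 'I_d) (mem_enum _ i)).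
  by elim: (enum _) => //= j s ->; case: (j == i).
by apply: eq_map => j; rewrite ffunE; case: (j == i).
Qed.

End multi_indices.

(* There are at most [d ^ l] multi-indices of degree [l]. *)
Lemma Dnorm_le (R : realType) (d l : nat) (F : 'rV[R]_d -> R) (M : R) :
  (0 < d)%N -> 0 <= M ->
  (forall s, size s = l -> forall x, `|partials F s x| <= M) ->
  0 <= fine (Dnorm l F) <= Num.sqrt ((d ^ l)%:R) * M.
Proof.
move=> d0 M0 FM.
have le : (Dnorm l F <= (Num.sqrt ((d ^ l)%:R) * M)%:E)%E.
  apply: supnorm_le => x; rewrite ger0_norm ?sqrtr_ge0//.
  rewrite -[X in _ * X](ger0_norm M0) -sqrtr_sqr -sqrtrM ?ler0n//.
  apply: ler_wsqrtr.
  apply: (@le_trans _ _ (\sum_(a : mindex d l | mdegree a == l) M ^+ 2)).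
    apply: ler_sum => a /eqP al; rewrite -[leLHS]real_normK ?num_real//.
    rewrite ler_pXn2r ?nnegrE//; apply: FM.
    by rewrite -[RHS]al; exact: size_mword.
  rewrite sumr_const -[leLHS]mulr_natl ler_wpM2r ?sqr_ge0// ler_nat.
  exact: card_mdegree.
(* With [le] this makes [Dnorm l F] finite, so that [fine] keeps its value. *)
have ge : (0 <= Dnorm l F)%E.
  apply: le_trans (ereal_sup_ubound _); last by exists 0.
  by rewrite lee_fin.
apply/andP; split; first exact: fine_ge0.
by rewrite -lee_fin fineK// ge0_fin_numE// (le_lt_trans le) ?ltry.
Qed.

(** * From the mollifier to a kernel *)

(** The direction has no time component, so the two difference quotients agree for every [h]. *)
Lemma derive_slice (R : realType) (d : nat) (F : 'rV[R]_d -> R)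
    (g : 'rV[R]_(1 + d) -> R) (t : R) (x : 'rV[R]_d) (i : 'I_d) :
  (forall y, F y = g (row_mx (const_mx t : 'rV_1) y)) ->
  'D_(delta_mx ord0 i : 'rV[R]_d) F x =
  'D_(delta_mx ord0 (rshift 1 i) : 'rV[R]_(1 + d)) g
    (row_mx (const_mx t : 'rV_1) x).
Proof.
move=> Fg; rewrite /derive [X in lim (X @ _) = _](_ : _ = (fun h : R =>
  h^-1 *: ((g \o shift (row_mx (const_mx t : 'rV_1) x))
    (h *: (delta_mx ord0 (rshift 1 i) : 'rV[R]_(1 + d))) -
  g (row_mx (const_mx t : 'rV_1) x))))//.
by apply/funext => h /=; rewrite add_scale_row_mx !Fg.
Qed.

(** The kernel is the smooth extension of [eta]; all integrals are over nonnegative times, where the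
    two coincide. *)
Lemma mollifier_kernel (R : realType) (d : nat) (eta : R -> 'rV[R]_d -> R) :
  mollifier eta -> exists g : 'rV[R]_(1 + d) -> R,
  [/\ kernel_fun g, forall z, @halfspace R d z -> 0 <= g (zrow z),
    L1norm g = 1 &
    forall i, L1norm ('D_(delta_mx ord0 (rshift 1 i) : 'rV[R]_(1 + d)) g)
      <= b01 eta].
Proof.
move=> [eta0 [g sg etag] supp int1]; exists g.
have kg : kernel_fun g.
  split=> // t x t0; rewrite -etag// => gx.
  have [] : [set z : R * 'rV[R]_d | 0 <= z.1 <= 1 /\ enorm z.2 <= 1] (t, x).
    by apply: supp; exact: subset_closure.
  by move=> /= /andP[].
have hs z : @halfspace R d z -> 0 <= z.1.
  by rewrite /halfspace/= in_itv/= andbT => -[].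
have g0 z : @halfspace R d z -> 0 <= g (zrow z).
  by move=> /hs z0; rewrite -etag// eta0.
split => //.
  rewrite /L1norm /Rintegral -[RHS]/(fine 1%E) -int1; congr fine.
  apply: eq_integral => z; rewrite inE => hz.
  by rewrite ger0_norm ?g0// etag// hs.
have intE (a : mindex d 1) i : mword a = [:: i] ->
  (\int[(@lebesgue_measure R \x lebesgueN R d)]_(z in `[0%R, +oo[ `*` setT)
      `|mderiv a (eta z.1) (row_of_tuple z.2)|%:E =
  (L1norm ('D_(delta_mx ord0 (rshift 1 i) : 'rV[R]_(1 + d)) g))%:E)%E.
  move=> ai; rewrite /L1norm /Rintegral fineK; last first.
    apply: integrable_fin_num; first exact: measurable_halfspace.
    exact: integrable_kernel_norm (kernel_fun_derive i kg).
  apply: eq_integral => z; rewrite inE => /hs z0.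
  rewrite /mderiv -/(mword a) ai /=; congr (`|_|%:E).
  by rewrite (derive_slice (g := g) (t := z.1))// => y; rewrite etag.
move=> i; rewrite -lee_fin -(intE _ _ (mword_munit i)).
rewrite /b01; set B := (X in fine X).
(* [b01] is the [fine] of an extended maximum, which bounds its terms only when finite. A
   multi-index of degree 1 is a one-letter word, so each term is a real L1 norm. *)
have Bfin : B \is a fin_num.
  apply: (big_ind (fun x : \bar R => x \is a fin_num)) => //.
    by move=> x y xf yf; case: (leP x y).
  move=> a; rewrite -size_mword => /eqP sa.
  case aj : (mword a) sa => [//|j [|//]] _.
  by rewrite (intE a j aj) fin_numE.
rewrite fineK// /B; apply: (@le_bigmax_cond _ _ _ _ _ _ (fun a : mindex d 1 =>
  \int[(@lebesgue_measure R \x lebesgueN R d)%E]_(z in `[0%R, +oo[ `*` setT)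
      `|mderiv a (eta z.1) (row_of_tuple z.2)|%:E)%E).
by rewrite -size_mword mword_munit.
Qed.

(** * The weighted norm and iterates of one step *)

Lemma normk_leP (R : realType) (d : nat) (kappa F : 'rV[R]_d -> R) (M : R) :
  (normk kappa F <= M%:E)%E <-> forall x, `|F x| * kappa x <= M.
Proof.
split=> [FM x|FM].
  by rewrite -lee_fin; apply: le_trans FM; apply: ereal_sup_ubound; exists x.
by apply: ge_ereal_sup => _ [x _ <-]; rewrite lee_fin.
Qed.

Lemma bounded_Ckappa (R : realType) (d : nat) (kappa F : 'rV[R]_d -> R)
    (M : R) :
  weight kappa -> 0 <= M -> continuous F -> (forall x, `|F x| <= M) ->
  Ckappa kappa F.
Proof.
move=> [_ k01 _] M0 cF FM; split=> //; apply: le_lt_trans (ltry M).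
apply/normk_leP => x; have /andP[k0 k1] := k01 x.
by rewrite -[M]mulr1 ler_pM// ltW.
Qed.

Section iterates.
Context (R : realType) (d : nat) (kappa : 'rV[R]_d -> R)
  (A : ('rV[R]_d -> R) -> ('rV[R]_d -> R)) (omega h : R).
Hypothesis kappa0 : forall x, 0 <= kappa x.
Hypotheses (omega0 : 0 <= omega) (h0 : 0 <= h).
Hypothesis AC : forall u, Ckappa kappa u -> Ckappa kappa (A u).
Hypothesis AL : forall u v, Ckappa kappa u -> Ckappa kappa v ->
  (normk kappa (A u \- A v) <= (expR (omega * h))%:E * normk kappa (u \- v))%E.

Lemma iter_Ckappa k u : Ckappa kappa u -> Ckappa kappa (iter k A u).
Proof. by move=> uC; elim: k => //= k; exact: AC. Qed.

Lemma iter_lipschitz k u v M : Ckappa kappa u -> Ckappa kappa v ->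
  (normk kappa (u \- v) <= M%:E)%E ->
  (normk kappa (iter k A u \- iter k A v) <=
    (expR (omega * (k%:R * h)) * M)%:E)%E.
Proof.
move=> uC vC uv; elim: k => [|k IH].
  by rewrite /= mul0r mulr0 expR0 mul1r.
rewrite !iterS (le_trans (AL (iter_Ckappa k uC) (iter_Ckappa k vC)))//.
rewrite -natr1 mulrDl mul1r mulrDr expRD -mulrA mulrCA EFinM.
by apply: lee_wpmul2l => //; rewrite lee_fin expR_ge0.
Qed.

(** Sum of [m] increments. Each compares the same iterate at [A u] and at [u], which costs at most
    [expR (omega * T)] because the elapsed time stays below [T]. *)
Lemma iter_telescope (T C : R) m l u : Ckappa kappa u -> 0 <= C ->
  (normk kappa (A u \- u) <= C%:E)%E -> (l + m)%:R * h <= T ->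
  (normk kappa (iter (l + m) A u \- iter l A u) <=
   (expR (omega * T) * (C * m%:R))%:E)%E.
Proof.
move=> uC C0 Au; elim: m => [|m IH] lm.
  rewrite addn0 mulr0 mulr0; apply/normk_leP => x.
  by rewrite /= subrr normr0 mul0r.
have lm' : (l + m)%:R * h <= T.
  by apply: le_trans lm; rewrite ler_wpM2r// ler_nat addnS.
apply/normk_leP => x.
have /normk_leP/(_ x) a1 := IH lm'.
have /normk_leP/(_ x) a2 := iter_lipschitz (l + m) (AC uC) uC Au.
rewrite /= addnS iterSr -(subrKA (iter (l + m) A u x)).
rewrite (le_trans (ler_wpM2r (kappa0 x) (ler_normD _ _)))// mulrDl.
rewrite -natr1 mulrDr mulr1 mulrDr addrC lerD// (le_trans a2)//.
by rewrite ler_wpM2r// ler_expR ler_wpM2l.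
Qed.

(** Triangle inequality through the iterates of [v]: the one-step bound is required of [v] alone,
    and exchanging [u] for [v] costs [e] at both ends. *)
Lemma iter_dist (T C e : R) k l u v : Ckappa kappa u -> Ckappa kappa v ->
  0 <= C -> 0 <= e -> (normk kappa (u \- v) <= e%:E)%E ->
  (normk kappa (A v \- v) <= C%:E)%E ->
  k%:R * h <= T -> l%:R * h <= T ->
  forall x, `|iter k A u x - iter l A u x| * kappa x <=
    expR (omega * T) * (2 * e + C * `|k%:R - l%:R|).
Proof.
move=> uC vC C0 e0 uv Av.
wlog lk : k l / (l <= k)%N.
  move=> H kT lT x; have [lk|/ltnW kl] := leqP l k; first exact: H.
  by rewrite distrC (distrC k%:R); exact: H.
move=> kT lT x.
have near n : n%:R * h <= T ->
    `|iter n A u x - iter n A v x| * kappa x <= expR (omega * T) * e.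
  move=> nT; have /normk_leP/(_ x) b := iter_lipschitz n uC vC uv.
  by rewrite (le_trans b)// ler_wpM2r// ler_expR ler_wpM2l.
have := @iter_telescope T C (k - l) l v vC C0 Av.
rewrite subnKC// => /(_ kT)/normk_leP/(_ x) b.
rewrite -natrB// normr_nat.
have tri : `|iter k A u x - iter l A u x| <= `|iter k A u x - iter k A v x| +
    `|iter k A v x - iter l A v x| + `|iter l A u x - iter l A v x|.
  rewrite (distrC (iter l A u x)).
  rewrite (le_trans _ (lerD (ler_normD _ _) (lexx _)))//.
  by rewrite (le_trans _ (ler_normD _ _))// subrKA addrA subrK.
apply: le_trans (ler_wpM2r (kappa0 x) tri) _; rewrite !mulrDl.
have := lerD (lerD (near k kT) b) (near l lT); move/le_trans; apply.
by rewrite addrAC mulrDr lerD2r !mul1r mulrDr.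
Qed.

End iterates.

(** * Passage to the limit in the step size *)

(** By maximality of [kmax], rounding [t] down to the grid loses at most [h n]. *)
Lemma kmax_cvg (R : realType) (h : nat -> R) (t : R) : (forall n, 0 < h n) ->
  h @ \oo --> 0 -> 0 <= t -> (fun n => (kmax (h n) t)%:R * h n) @ \oo --> t.
Proof.
move=> h0 hc t0; apply/cvgrPdist_le => e e0.
near=> n.
have k1 : (kmax (h n) t)%:R * h n <= t by rewrite -kmax_max.
have k2 : t < (kmax (h n) t).+1%:R * h n.
  by rewrite ltNge -kmax_max// ltnn.
rewrite ger0_norm ?subr_ge0// lerBlDl (le_trans (ltW k2))//.
rewrite -natr1 mulrDl mul1r lerD2l.
by near: n; exact: (cvgr_le 0 hc).
Unshelve. all: by end_near. Qed.

Lemma mixed_cvg_pointwise (R : realType) (d : nat) (kappa : 'rV[R]_d -> R)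
    u f x :
  mixed_cvg kappa u f -> u ^~ x @ \oo --> f x.
Proof.
move=> [_ _ _ /fam_cvgP uf].
have : {uniform [set x], u @ \oo --> f} by apply: uf; exact: compact_set1.
by rewrite uniform_set1.
Qed.

(** * The estimates for the iterates and for the semigroup *)

Theorem theorem2p11 (R : realType) (d : nat) (hd : (0 < d)%N)
  (kappa : 'rV[R]_d -> R) (hkappa : weight kappa)
  (eta : R -> 'rV[R]_d -> R) (heta : mollifier eta)
  (h : nat -> R) (I S : R -> ('rV[R]_d -> R) -> ('rV[R]_d -> R))
  (omega t0 eps0 L : R)
  (homega : 0 <= omega) (ht0 : 0 < t0) (heps0 : 0 < eps0 <= 1) (hL : 0 <= L)
  (hI : admissible kappa h I omega t0 eps0 L)
  (hS : associated_semigroup kappa h I S)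
  (rho1 : R -> R -> R)
  (rho1_ge0 : forall a b, 0 <= a -> 0 <= b -> 0 <= rho1 a b)
  (rho1_nd : forall a a' b b', 0 <= a <= a' -> 0 <= b <= b' ->
    rho1 a b <= rho1 a' b')
  (hrho1 : forall n f, Cbinf f ->
    (normk kappa (I (h n) f \- f) <=
     (rho1 ((Num.sqrt d%:R)^-1 * fine (Dnorm 1 f))
           (d%:R^-1 * fine (Dnorm 2 f)) * h n)%:E)%E)
  (r T delta : R) (hr : 0 <= r) (hT : 0 <= T) (hdelta : 0 < delta)
  (f : 'rV[R]_d -> R) (hf : Lipb r f) :
  (forall k l n : nat, (0 < k)%N -> (0 < l)%N ->
     k%:R * h n <= T -> l%:R * h n <= T ->
     (normk kappa (iter k (I (h n)) f \- iter l (I (h n)) f) <=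
      (expR (omega * T) *
       (2 * r * delta +
        rho1 r (b01 eta * r * delta^-1) * `|k%:R - l%:R| * h n))%:E)%E) /\
  (forall s t : R, 0 <= s <= T -> 0 <= t <= T ->
     (normk kappa (S s f \- S t f) <=
      (expR (omega * T) *
       (2 * r * delta +
        rho1 r (b01 eta * r * delta^-1) * `|s - t|))%:E)%E).
Proof.
have [g [kg g0 g1 gb]] := mollifier_kernel heta.
have [_ k01 _] := hkappa.
have kappa0 x : 0 <= kappa x by have /andP[/ltW] := k01 x.
have kappa1 x : kappa x <= 1 by have /andP[_] := k01 x.
have cf : continuous f by have [fL _] := hf; exact: lipschitz_continuous fL.
have fC : Ckappa kappa f by exact: bounded_Ckappa (fun x => Lipb_bounded x hf).
pose v := mollify delta f g.
have vI : Cbinf v by exact: Cbinf_mollify hr hf hdelta _ kg.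
have vC : Ckappa kappa v.
  apply: (bounded_Ckappa hkappa (M := r * L1norm g)).
  - by rewrite g1 mulr1.
  - by have [/(_ [::])[]] := vI.
  - by move=> x; exact: mollify_bounded.
set rho := rho1 _ _.
have b0 : 0 <= b01 eta.
  apply: le_trans (gb (Ordinal hd)).
  by apply: Rintegral_ge0.
have B0 : 0 <= b01 eta * r * delta^-1.
  by rewrite !mulr_ge0// invr_ge0 ltW.
have rho0 : 0 <= rho by exact: rho1_ge0.
have d0 : 0 < d%:R :> R by rewrite ltr0n.
have /andP[D10 D11] : 0 <= fine (Dnorm 1 v) <= Num.sqrt ((d ^ 1)%:R) * r.
  apply: Dnorm_le => // -[|i [|]]// _ x.
  by rewrite -[leRHS]mulr1 -g1; exact: partials_mollify1_le.
(* The at most [d ^ 2] multi-indices give the factor [Num.sqrt (d ^ 2) = d], which the [d^-1] in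
   [rho1] cancels; in first order [Num.sqrt d] cancels likewise. *)
have /andP[D20 D21] : 0 <= fine (Dnorm 2 v) <=
    Num.sqrt ((d ^ 2)%:R) * (b01 eta * r * delta^-1).
  apply: Dnorm_le => // -[|i [|j [|]]]// _ x.
  apply: le_trans (partials_mollify2_le hr hf hdelta i j x kg) _.
  by rewrite [leRHS]mulrC [b01 _ * _]mulrC !ler_wpM2l// invr_ge0 ltW.
have h01 n : 0 < h n <= 1 by exact: adm_step hI n.
have Iv n : (normk kappa (I (h n) v \- v) <= (rho * h n)%:E)%E.
  apply: le_trans (hrho1 n v vI) _; rewrite lee_fin.
  have /andP[/ltW hn0 _] := h01 n; rewrite ler_wpM2r//; apply: rho1_nd.
    rewrite mulr_ge0 ?invr_ge0 ?sqrtr_ge0//=.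
    by rewrite ler_pdivrMl ?sqrtr_gt0//; rewrite expn1 in D11.
  rewrite mulr_ge0 ?invr_ge0 ?ler0n//=.
  by rewrite ler_pdivrMl//; move: D21; rewrite natrX sqrtr_sqr normr_nat.
have fv : (normk kappa (f \- v) <= (r * delta)%:E)%E.
  apply/normk_leP => x; rewrite /= distrC.
  have D := mollify_dist_le hr hf hdelta x kg g0 g1.
  by rewrite -[leRHS]mulr1 ler_pM.
(* Stated in terms of the times [k%:R * h n] and [l%:R * h n], so that it also covers step counts
   varying with [n] in the limit. *)
have dist n k l : k%:R * h n <= T -> l%:R * h n <= T ->
    forall x, `|iter k (I (h n)) f x - iter l (I (h n)) f x| * kappa x <=
    expR (omega * T) * (2 * r * delta + rho * `|k%:R * h n - l%:R * h n|).
  move=> kT lT x; have /andP[/ltW hn0 hn1] := h01 n.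
  rewrite -mulrBl normrM (ger0_norm hn0) -(mulrA 2).
  rewrite (mulrC _ (h n)) [rho * _]mulrA.
  apply: (@iter_dist _ _ _ (I (h n)) omega (h n) kappa0 homega hn0 _ _
    T _ _ k l f v) => //.
  - by move=> u uC; exact: adm_Ckappa hI _ _ _ uC.
  - by move=> u w uC wC; apply: (adm_lipschitz hI) => //; rewrite hn0.
  - exact: mulr_ge0.
  - by rewrite mulr_ge0// ltW.
split=> [k l n _ _ kT lT|s t /andP[s0 sT] /andP[t0' tT]]; apply/normk_leP => x.
  have /andP[/ltW hn0 _] := h01 n.
  have := dist n k l kT lT x.
  by rewrite -mulrBl normrM (ger0_norm hn0) [rho * _]mulrA.
have hpos n : 0 < h n by have /andP[] := h01 n.
have hc := adm_step_cvg hI.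
(* With [x] fixed, the pointwise part of mixed convergence suffices. *)
have cs := mixed_cvg_pointwise (x := x) (hS s f s0 fC).
have ct := mixed_cvg_pointwise (x := x) (hS t f t0' fC).
have cl : (fun n => `|Ipi I h n s f x - Ipi I h n t f x| * kappa x) @ \oo -->
    `|S s f x - S t f x| * kappa x.
  by apply: cvgM; [apply: cvg_norm; exact: cvgB|exact: cvg_cst].
have cr : (fun n => expR (omega * T) * (2 * r * delta + rho *
    `|(kmax (h n) s)%:R * h n - (kmax (h n) t)%:R * h n|)) @ \oo -->
    expR (omega * T) * (2 * r * delta + rho * `|s - t|).
  apply: cvgM; first exact: cvg_cst.
  apply: cvgD; first exact: cvg_cst.
  apply: cvgM; first exact: cvg_cst.
  by apply: cvg_norm; apply: cvgB; exact: kmax_cvg.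
apply: (ler_cvg_to cl cr); apply: nearW => n; apply: dist.
  by apply: le_trans sT; rewrite -kmax_max.
by apply: le_trans tT; rewrite -kmax_max.
Qed.
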